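(* Let $A,B\ge 0$ be positive semidefinite $n\times n$ matrices and let $q\ge 0$. If $0\le r\le 1$, then $$\operatorname{Tr}\big[(ABA)^{rq}\big]\le \Big(\|A\|^{2rq}\,\operatorname{Tr}\big[B^{rq}\big]\Big)^{1-r}\,\Big(\operatorname{Tr}\big[(A^rB^rA^r)^q\big]\Big)^{r}.$$ If $r\ge 1$, the inequality is reversed, i.e. $$\operatorname{Tr}\big[(ABA)^{rq}\big]\ge \Big(\|A\|^{2rq}\,\operatorname{Tr}\big[B^{rq}\big]\Big)^{1-r}\,\Big(\operatorname{Tr}\big[(A^rB^rA^r)^q\big]\Big)^{r}.$$
   Context: Matrices are complex square matrices of the same size; $A\ge 0$ means that $A$ is (Hermitian) positive semidefinite. Powers of positive semidefinite matrices are defined by functional calculus. $\|\cdot\|$ denotes the operator norm, which for a positive semidefinite matrix is its largest eigenvalue. *)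

(* Defs.v *)
From HB Require Import structures.
From mathcomp Require Import all_boot all_order all_algebra.
From mathcomp Require Import spectral sesquilinear.
From mathcomp Require Import all_classical all_reals all_analysis.
From mathcomp Require Import complex.

Set Implicit Arguments.
Unset Strict Implicit.
Unset Printing Implicit Defensive.

Import Order.TTheory GRing.Theory Num.Theory.
Local Open Scope classical_set_scope.
Local Open Scope ring_scope.
Local Open Scope complex_scope.
Local Open Scope sesquilinear_scope.

(* On R[i] the inequality 0 <= z says that z is real and nonnegative. *)
Definition psd (R : realType) (n : nat) (A : 'M[R[i]]_n) : Prop :=
  A \is hermsymmx /\ forall v : 'cV[R[i]]_n, 0 <= (v ^t* *m A *m v) 0 0.

(* The spectral decomposition is A = U^-1 *m diag_mx d *m U, with U unitary.
   The result does not depend on the chosen decomposition (mxfunE).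
   The eigenvalues of a Hermitian matrix are real, hence Re loses nothing
   there; on other matrices the value is junk. *)
Definition mxfun (R : realType) (n : nat) (f : R -> R) (A : 'M[R[i]]_n) :
    'M[R[i]]_n :=
  invmx (spectralmx A)
    *m diag_mx (map_mx (fun z : R[i] => (f (complex.Re z))%:C) (spectral_diag A))
    *m spectralmx A.

(* By the convention 0 `^ 0 = 1 for powR, mxpow A 0 = 1%:M. *)
Definition mxpow (R : realType) (n : nat) (A : 'M[R[i]]_n) (s : R) :
    'M[R[i]]_n :=
  mxfun (fun x : R => x `^ s) A.

Definition l2norm (R : realType) (n : nat) (v : 'cV[R[i]]_n) : R :=
  Num.sqrt (\sum_(i < n) complex.Re `|v i 0| ^+ 2).

Definition opnorm (R : realType) (n : nat) (A : 'M[R[i]]_n) : R :=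
  sup [set l2norm (A *m v) | v in [set v : 'cV[R[i]]_n | l2norm v <= 1]].

(* The trace of a Hermitian matrix is real: rtr is that real number. *)
Definition rtr (R : realType) (n : nat) (A : 'M[R[i]]_n) : R :=
  complex.Re (\tr A).

Lemma mxfunE (R : realType) (n : nat) (f : R -> R) (U : 'M[R[i]]_n)
    (d : 'rV[R[i]]_n) : U \is unitarymx ->
  mxfun f (invmx U *m diag_mx d *m U) =
  invmx U *m diag_mx (map_mx (fun z : R[i] => (f (complex.Re z))%:C) d) *m U.
Proof.
move=> Uu; set A := invmx U *m _ *m U; rewrite /mxfun.
have An : A \is normalmx.
  by apply/orthomx_spectral_subproof; exists (U, d).
have /orthomx_spectralP := An.
set P := spectralmx A; set e := spectral_diag A => AE.
have Pu : P \in unitmx by exact: spectral_unit.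
have Uu' : U \in unitmx by exact: unitarymx_unit.
pose W := P *m invmx U.
have WE : diag_mx e *m W = W *m diag_mx d.
  have : P *m A *m invmx U = P *m A *m invmx U by [].
  by rewrite {1}AE {1}/A !mulmxA mulmxV// mul1mx -!mulmxA mulmxV// mulmx1 !mulmxA.
have Wu : W \in unitmx by rewrite unitmx_mul Pu unitmx_inv.
have PE : P = W *m U by rewrite /W -mulmxA mulVmx// mulmx1.
clearbody W.
set g := fun z : R[i] => _.
have WgE : diag_mx (map_mx g e) *m W = W *m diag_mx (map_mx g d).
  apply/matrixP => i j; move/matrixP/(_ i j): WE.
  rewrite !mul_diag_mx !mul_mx_diag !mxE => /eqP.
  rewrite [_ * d 0 j]mulrC -subr_eq0 -mulrBl mulf_eq0 subr_eq0.
  by case/orP => /eqP ->; rewrite ?mulr0 ?mul0r// mulrC.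
rewrite PE.
have -> : invmx (W *m U) = invmx U *m invmx W.
  have WUu : W *m U \in unitmx by rewrite unitmx_mul Wu Uu'.
  rewrite -[RHS]mulmx1 -(mulmxV WUu) !mulmxA.
  by rewrite -[invmx U *m _ *m W]mulmxA mulVmx// mulmx1 mulVmx// mul1mx.
rewrite -!mulmxA [diag_mx _ *m (W *m U)]mulmxA WgE !mulmxA.
by rewrite -[invmx U *m _ *m W]mulmxA mulVmx// mulmx1.
Qed.

(* Main.v *)
Require Import Defs.
From mathcomp Require Import all_boot all_order all_algebra.
From mathcomp Require Import fingroup perm spectral sesquilinear.
From mathcomp Require Import all_classical all_reals all_analysis.
From mathcomp Require Import complex.
From mathcomp Require Import ring.

Set Implicit Arguments.
Unset Strict Implicit.
Unset Printing Implicit Defensive.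

Import Order.TTheory GRing.Theory Num.Theory.
Local Open Scope ring_scope.
Local Open Scope complex_scope.
Local Open Scope sesquilinear_scope.

(** For [0 <= r <= 1] write the sandwich as
      [ABA = A^(1-r) A^r (B^(r/2) B^(1-r) B^(r/2)) A^r A^(1-r)].
    With all traces expressed through singular values the claim is Hoelder's
    inequality for the product [B^((1-r)/2) . (B^(r/2) A^r) . A^(1-r)] in
    Schatten classes whose exponents may be smaller than one, so the proof goes
    through log-majorization rather than through norms.

    Let [a], [b], [c], [l] be the decreasing eigenvalues of [A], [B],
    [A^r B^r A^r] and [ABA].  The determinant of a compression satisfies
      [det (Y^* H Y) <= (h_0 ... h_(k-1)) det (Y^* Y)]
    for every positive semidefinite [H] with decreasing eigenvalues [h] and
    every [n x k] matrix [Y] ([det_eigmx_le]); it follows from a Cauchy-Binet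
    formula ([cauchy_binet_sym]), because each [k x k] minor of [Y] enters with
    a product of [k] distinct eigenvalues.  When the columns of [Z] are the top
    [k] eigenvectors of [ABA], [det (Z^* ABA Z)] equals [l_0 ... l_(k-1)].
    Peeling off [B^(1-r)], then [A^r B^r A^r], then [A^(2(1-r))]
    ([det_sandwich_le]) gives, for all [k],
      [prod_(j<k) l_j <= prod_(j<k) a_0^(2(1-r)) b_j^(1-r) c_j]
    ([log_majorization]).  Raising to the power [rq] and passing from products
    to sums ([prod_le_sum_le]), then applying the scalar Hoelder inequality
    ([sum_powR_hoelder]), yields the first claim.

    For [r >= 1], the first claim with [1/r], [rq], [A^r], [B^r] in place of
    [r], [q], [A], [B] bounds the trace of [(A^r B^r A^r)^q] from above by means
    of that of [(ABA)^(rq)]; solving for the latter gives the reversed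
    inequality. *)

(** * Real powers and decreasing sequences *)

(** With [0 `^ 0 = 1], the law of exponents holds at the base [0] as well, as
    long as no exponent is negative. *)
Lemma powRD_ge0 (R : realType) (x s t : R) : 0 <= s -> 0 <= t ->
  x `^ (s + t) = x `^ s * x `^ t.
Proof.
move=> s0 t0; have [/eqP|st] := eqVneq (s + t) 0; last first.
  by rewrite powRD // (negbTE st).
by rewrite paddr_eq0 // => /andP[/eqP-> /eqP->]; rewrite addr0 powRr0 mulr1.
Qed.

Lemma powR_prod (R : realType) k (x : nat -> R) (p : R) : (forall j, 0 <= x j) ->
  \prod_(j < k) x j `^ p = (\prod_(j < k) x j) `^ p.
Proof.
move=> x0; elim: k => [|k IH]; first by rewrite !big_ord0 powR1.
by rewrite !big_ord_recr /= IH powRM ?prodr_ge0.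
Qed.

Lemma nonincreasing_powR (R : realType) (d : nat -> R) (s : R) : 0 <= s ->
  nonincreasing_seq d -> (forall j, 0 <= d j) ->
  nonincreasing_seq (fun j => d j `^ s).
Proof. by move=> s0 d_dec d0 i j ij; rewrite ge0_ler_powR ?nnegrE ?d0 ?d_dec. Qed.

(** Raise the hypothesis to the power [r] and divide by [y `^ (r - 1)]; when
    [y = 0] the left-hand side vanishes unless [r = 1]. *)
Lemma powR_le_solve (R : realType) (x y z r : R) :
  1 <= r -> 0 <= x -> 0 <= z ->
  x <= y `^ (1 - r^-1) * z `^ r^-1 -> y `^ (1 - r) * x `^ r <= z.
Proof.
move=> r1 x0 z0 xle; have r0 : 0 < r := lt_le_trans ltr01 r1.
apply: (@le_trans _ _ (y `^ (1 - r) * (y `^ (r - 1) * z))).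
  rewrite ler_wpM2l ?powR_ge0 //.
  have -> : y `^ (r - 1) * z = (y `^ (1 - r^-1) * z `^ r^-1) `^ r.
    rewrite powRM ?powR_ge0 // -!powRrM mulVf ?gt_eqF // powRr1 //.
    by rewrite mulrBl mul1r mulVf ?gt_eqF.
  by rewrite ge0_ler_powR ?nnegrE ?mulr_ge0 ?powR_ge0 // ltW.
rewrite mulrA ler_piMl //.
have [->|yN0] := eqVneq y 0.
  by rewrite -[leRHS]mulr1 ler_pM ?powR_ge0 // /powR eqxx; case: eqP.
by rewrite -powRD ?yN0 ?implybT // subrKA subrr powRr0.
Qed.

Lemma young_powR (R : realType) (x y r : R) : 0 <= x -> 0 <= y -> 0 < r < 1 ->
  x `^ (1 - r) * y `^ r <= (1 - r) * x + r * y.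
Proof.
move=> x0 y0 /andP[r0 r1]; have r1' : 0 < 1 - r by rewrite subr_gt0.
have := @conjugate_powR R (x `^ (1 - r)) (y `^ r) (1 - r)^-1 r^-1.
rewrite !powR_ge0 !invr_gt0 r1' r0 !invrK subrK => /(_ isT isT isT isT erefl).
by rewrite -!powRrM !mulfV ?gt_eqF // !powRr1 // (mulrC x) (mulrC y).
Qed.

(** Young's inequality applied to the terms normalized by their sums.  The
    end points of the range of [r], and the vanishing sums, have to be set
    apart because [0 `^ 0 = 1]. *)
Lemma sum_powR_hoelder (R : realType) (n : nat) (b c : 'I_n -> R) (r : R) :
  (forall j, 0 <= b j) -> (forall j, 0 <= c j) -> 0 <= r <= 1 ->
  \sum_j b j `^ (1 - r) * c j `^ r <=
  (\sum_j b j) `^ (1 - r) * (\sum_j c j) `^ r.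
Proof.
move=> b0 c0 /andP[]; rewrite le_eqVlt => /predU1P[<- _|r0].
  rewrite subr0 powRr0 powRr1 ?sumr_ge0 // mulr1.
  by apply: ler_sum => j _; rewrite powRr0 powRr1 ?mulr1.
rewrite le_eqVlt => /predU1P[->|r1].
  rewrite subrr powRr0 powRr1 ?sumr_ge0 // mul1r.
  by apply: ler_sum => j _; rewrite powRr0 powRr1 ?mul1r.
set B := \sum_j b j; set C := \sum_j c j.
have r1' : 1 - r != 0 by rewrite subr_eq0 gt_eqF.
have sum0 (e : 'I_n -> R) : (forall j, 0 <= e j) -> \sum_j e j = 0 ->
    forall j, e j = 0.
  move=> e0 /eqP; rewrite psumr_eq0 // => /allP + j.
  by move=> /(_ j (mem_index_enum _))/eqP.
have [B0|B0] := eqVneq B 0.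
  rewrite B0 powR0 // mul0r big1 // => j _.
  by rewrite (sum0 _ b0 B0) powR0 // mul0r.
have [C0|C0] := eqVneq C 0.
  rewrite C0 powR0 ?gt_eqF // mulr0 big1 // => j _.
  by rewrite (sum0 _ c0 C0) powR0 ?gt_eqF // mulr0.
have Bp : 0 < B by rewrite lt_def B0 sumr_ge0.
have Cp : 0 < C by rewrite lt_def C0 sumr_ge0.
apply: (@le_trans _ _ (\sum_j (B `^ (1 - r) * C `^ r) *
                          ((1 - r) * (b j / B) + r * (c j / C)))); last first.
  rewrite -mulr_sumr big_split /= -!mulr_sumr -!mulr_suml -/B -/C.
  by rewrite !divff // !mulr1 subrK mulr1.
apply: ler_sum => j _.
have -> : b j `^ (1 - r) * c j `^ r =
   (B `^ (1 - r) * C `^ r) * ((b j / B) `^ (1 - r) * (c j / C) `^ r).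
  rewrite mulrACA -!powRM ?divr_ge0 ?(ltW Bp) ?(ltW Cp) //.
  by rewrite [B * _]mulrC [C * _]mulrC !divfK.
rewrite ler_wpM2l ?mulr_ge0 ?powR_ge0 //.
rewrite young_powR ?divr_ge0 ?(ltW Bp) ?(ltW Cp) //.
by rewrite r0 r1.
Qed.

(** Summation by parts: nonnegative partial sums of [x] keep the weighted sum
    nonnegative when the weights are nonnegative and decrease.  The explicit
    lower bound is what makes the induction on the number of terms go through. *)
Lemma abel_sum_ge (R : realType) (a x : nat -> R) :
  nonincreasing_seq a -> forall n,
  (forall k, (k <= n)%N -> 0 <= \sum_(j < k) x j) ->
  a n * \sum_(j < n) x j <= \sum_(j < n) a j * x j.
Proof.
move=> a_dec; elim=> [|n IH] x_ge; first by rewrite !big_ord0 mulr0.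
have {}IH := IH (fun k kn => x_ge k (leqW kn)).
have S0 := x_ge n (leqnSn n); have S1 := x_ge n.+1 (leqnn _).
apply: (@le_trans _ _ (a n * \sum_(j < n.+1) x j)).
  by rewrite ler_wpM2r // a_dec.
by rewrite !big_ord_recr /= mulrDr lerD2r.
Qed.

(** Weak log-majorization implies weak majorization.  As [ln t <= t - 1], the
    sum of [b j - a j = a j * (b j / a j - 1)] is at least that of
    [a j * ln (b j / a j)], and the partial sums of the logarithms are
    nonnegative by hypothesis, so that [abel_sum_ge] applies.  The vanishing
    terms of [a] come last and are dropped by the induction on [n]. *)
Lemma prod_le_sum_le (R : realType) (a b : nat -> R) (n : nat) :
  nonincreasing_seq a -> (forall j, 0 <= a j) -> (forall j, 0 <= b j) ->
  (forall k, (k <= n)%N -> \prod_(j < k) a j <= \prod_(j < k) b j) ->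
  \sum_(j < n) a j <= \sum_(j < n) b j.
Proof.
move=> a_dec a_ge0 b_ge0; elim: n => [|n IH] maj; first by rewrite !big_ord0.
have [an0|an_neq0] := eqVneq (a n) 0.
  rewrite !big_ord_recr /= an0 lerD //.
  by apply: IH => k kn; exact/maj/leqW.
have a_gt0 j : (j <= n)%N -> 0 < a j.
  by move=> jn; rewrite (lt_le_trans _ (a_dec _ _ jn)) // lt_def an_neq0 a_ge0.
have b_gt0 j : (j <= n)%N -> 0 < b j.
  move=> jn; rewrite lt_def b_ge0 andbT; apply/eqP => bj0.
  have := maj n.+1 (leqnn _).
  rewrite [leRHS](bigD1 (Ordinal (jn : j < n.+1)%N)) //=.
  rewrite bj0 mul0r leNgt => /negP; apply.
  by apply: prodr_gt0 => i _; apply: a_gt0; rewrite -ltnS.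
pose x j := ln (b j / a j).
have x_sum k : (k <= n.+1)%N -> 0 <= \sum_(j < k) x j.
  move=> kn.
  have -> : \sum_(j < k) x j = ln (\prod_(j < k) (b j / a j)).
    elim: k kn => [|k IHk] kn; first by rewrite !big_ord0 ln1.
    rewrite !big_ord_recr /= lnM ?IHk ?(ltnW kn) // posrE;
      rewrite ?divr_gt0 ?a_gt0 ?b_gt0 //.
    apply: prodr_gt0 => i _.
    by rewrite divr_gt0 ?a_gt0 ?b_gt0 // -ltnS (leq_trans (ltn_ord i)) // ltnW.
  apply: ln_ge0; rewrite big_split /= prodfV.
  have pos : 0 < \prod_(j < k) a j.
    by apply: prodr_gt0 => i _; rewrite a_gt0 // -ltnS (leq_trans (ltn_ord i)).
  by rewrite ler_pdivlMr // mul1r maj.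
have := abel_sum_ge a_dec x_sum.
have ge0 : 0 <= a n.+1 * \sum_(j < n.+1) x j by rewrite mulr_ge0 ?a_ge0 ?x_sum.
move=> /(le_trans ge0) Sge0.
rewrite -subr_ge0 -sumrB; apply: (le_trans Sge0); apply: ler_sum => j _.
have aj := a_gt0 j (ltn_ord j); have bj := b_gt0 j (ltn_ord j).
have lnle : x j <= b j / a j - 1.
  have := @le_ln1Dx R (b j / a j - 1); rewrite [1 + _]addrC subrK; apply.
  by rewrite ltrBrDl subrr divr_gt0.
apply: (le_trans (ler_wpM2l (ltW aj) lnle)).
by rewrite mulrBr mulr1 mulrCA divff ?gt_eqF // mulr1.
Qed.

(** One of the [k] distinct indices is at least [k - 1], so its term is at
    most the last factor on the right; the others are handled by induction. *)
Lemma prod_inj_le (R : realType) (d : nat -> R) n k (f : 'I_k -> 'I_n) :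
  nonincreasing_seq d -> (forall j, 0 <= d j) -> injective f ->
  \prod_i d (f i) <= \prod_(i < k) d i.
Proof.
move=> d_dec d0; elim: k f => [|k IH] f f_inj; first by rewrite !big_ord0.
have [i ki] : exists i, (k <= f i)%N.
  apply/existsP; apply: contraT; rewrite negb_exists => /forallP fk.
  have fk' i : (f i < k)%N by rewrite ltnNge.
  have /leq_card : injective (fun i => Ordinal (fk' i)).
    by move=> i j [/ord_inj/f_inj].
  by rewrite !card_ord ltnn.
rewrite (bigD1_ord i) //= big_ord_recr /= mulrC ler_pM ?d_dec ?prodr_ge0 //.
by apply: (IH (f \o lift i)) => a b /f_inj /lift_inj.
Qed.

(** * Determinants of compressions *)

(** Multilinearity of the determinant in its rows. *)
Lemma det_mulmx_diag_expand (K : comNzRingType) k n (X : 'M[K]_(k, n))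
    (d : 'rV[K]_n) (Y : 'M[K]_(n, k)) :
  \det (X *m diag_mx d *m Y) =
  \sum_(f : {ffun 'I_k -> 'I_n})
     (\prod_i (X i (f i) * d 0 (f i))) * \det (rowsub f Y).
Proof.
rewrite /determinant.
under eq_bigr => s _.
  under eq_bigr => i _ do
    (rewrite mxE; under eq_bigr => l _ do rewrite mul_mx_diag mxE).
  rewrite bigA_distr_bigA /= big_distrr /=.
  over.
rewrite exchange_big /=; apply: eq_bigr => f _.
rewrite big_distrr /=; apply: eq_bigr => s _.
rewrite big_split /= mulrCA; congr (_ * (_ * _)).
by apply: eq_bigr => i _; rewrite !mxE.
Qed.

Lemma det_rowsub_perm (K : comNzRingType) k n (f : 'I_k -> 'I_n) (s : 'S_k)
    (Y : 'M[K]_(n, k)) :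
  \det (rowsub (f \o s) Y) = (-1) ^+ s * \det (rowsub f Y).
Proof.
have -> : rowsub (f \o s) Y = perm_mx s *m rowsub f Y.
  by rewrite -row_permE; apply/matrixP => i j; rewrite !mxE.
by rewrite det_mulmx det_perm.
Qed.

(** The Cauchy-Binet formula summed over all maps [f] instead of the subsets
    of size [k]: noninjective maps contribute [0], and every subset is counted
    once for each of its [k`!] enumerations, which accounts for the factor on
    the left.  The proof averages [det_mulmx_diag_expand] over the
    reparametrizations of [f] by permutations, and so needs no choice of an
    enumeration for each subset. *)
Lemma cauchy_binet_sym (K : comNzRingType) k n (X : 'M[K]_(k, n)) (d : 'rV[K]_n)
    (Y : 'M[K]_(n, k)) :
  \det (X *m diag_mx d *m Y) *+ k`! =
  \sum_(f : {ffun 'I_k -> 'I_n})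
     (\prod_i d 0 (f i)) * (\det (colsub f X) * \det (rowsub f Y)).
Proof.
have perm_sum (s : 'S_k) : \det (X *m diag_mx d *m Y) =
    \sum_(f : {ffun 'I_k -> 'I_n}) (\prod_i d 0 (f i)) *
      ((-1) ^+ s * (\prod_i X i (f (s i))) * \det (rowsub f Y)).
  rewrite det_mulmx_diag_expand.
  pose reparam (f : {ffun 'I_k -> 'I_n}) := [ffun i => f (s i)].
  rewrite (reindex_inj (h := reparam)); last first.
    move=> f g /ffunP fg; apply/ffunP => i.
    by have := fg (s^-1%g i); rewrite !ffunE permKV.
  apply: eq_bigr => f _.
  have -> : rowsub [ffun i => f (s i)] Y = rowsub (f \o s) Y.
    by apply/matrixP => i j; rewrite !mxE ffunE.
  rewrite det_rowsub_perm big_split /=.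
  have -> : \prod_i d 0 ([ffun i0 => f (s i0)] i) = \prod_i d 0 (f i).
    rewrite [RHS](reindex_inj (@perm_inj _ s)).
    by apply: eq_bigr => i _; rewrite ffunE.
  under eq_bigr => i _ do rewrite ffunE.
  rewrite (mulrC (\prod_i X i _)) -!mulrA; congr (_ * _).
  by rewrite mulrCA.
rewrite -card_Sn -sumr_const /=.
under eq_bigr => s _ do rewrite (perm_sum s).
rewrite exchange_big /=.
apply: eq_bigr => f _; rewrite -mulr_sumr -mulr_suml; congr (_ * (_ * _)).
by apply: eq_bigr => s _; congr (_ * _); apply: eq_bigr => i _; rewrite mxE.
Qed.

Lemma det_rowsub_ninj (K : comNzRingType) k n (f : 'I_k -> 'I_n)
    (Y : 'M[K]_(n, k)) :
  ~~ injectiveb f -> \det (rowsub f Y) = 0.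
Proof.
move=> /injectivePn[i [j ij fij]]; apply: (determinant_alternate ij) => l.
by rewrite !mxE fij.
Qed.

(** In the expansion of both determinants by [cauchy_binet_sym], the map [f]
    carries the weight [`|\det (rowsub f Y)| ^+ 2], which is nonnegative and
    vanishes unless [f] is injective; the bound thus holds term by term. *)
Lemma det_gram_le (C : numClosedFieldType) k n (d : 'rV[C]_n) (P : C)
    (Y : 'M[C]_(n, k)) :
  (forall f : {ffun 'I_k -> 'I_n}, injective f -> \prod_i d 0 (f i) <= P) ->
  \det (Y^t* *m diag_mx d *m Y) <= P * \det (Y^t* *m Y).
Proof.
move=> dP; rewrite -(@ler_pMn2r _ k`!) ?fact_gt0 // -mulrnAr.
rewrite -[Y^t* in leRHS]mulmx1 -(diag_const_mx n (1 : C)) !cauchy_binet_sym.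
rewrite mulr_sumr; apply: ler_sum => f _.
have -> : colsub f (Y^t*) = (rowsub f Y)^t* by apply/matrixP => i j; rewrite !mxE.
rewrite det_map_mx det_tr.
rewrite [X in _ <= _ * (X * _)]big1 ?mul1r => [|i _]; last by rewrite mxE.
have [/injectiveP f_inj|f_ninj] := boolP (injectiveb f).
  by rewrite ler_wpM2r ?dP // mulrC mul_conjC_ge0.
by rewrite det_rowsub_ninj // !mulr0.
Qed.

Lemma adjmxM (C : numClosedFieldType) m p q (X : 'M[C]_(m, p)) (Y : 'M[C]_(p, q)) :
  (X *m Y)^t* = Y^t* *m X^t*.
Proof. by rewrite trmx_mul map_mxM. Qed.

Lemma det_compression_le (C : numClosedFieldType) k n (U : 'M[C]_n) (d : 'rV[C]_n)
    (P : C) (Y : 'M[C]_(n, k)) : U \is unitarymx ->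
  (forall f : {ffun 'I_k -> 'I_n}, injective f -> \prod_i d 0 (f i) <= P) ->
  \det (Y^t* *m (U^t* *m diag_mx d *m U) *m Y) <= P * \det (Y^t* *m Y).
Proof.
move=> Uu /(det_gram_le (U *m Y)); rewrite trmx_mul map_mxM !mulmxA.
by rewrite mulmxKtV.
Qed.

(** The determinantal form of Horn's inequalities for a product of three
    factors.  Each step reads the current Gram matrix as a compression of the
    next factor: first of [P] by [Q T S Z], then of [T Q^2 T] by [S Z], finally
    of [S^2] by [Z]. *)
Lemma det_sandwich_le (C : numClosedFieldType) n k (S T P Q : 'M[C]_n)
    (alpha beta gamma : C) (Z : 'M[C]_(n, k)) :
  S^t* = S -> T^t* = T -> Q^t* = Q -> 0 <= beta -> 0 <= gamma ->
  (forall Y : 'M[C]_(n, k),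
     \det (Y^t* *m (S *m S) *m Y) <= alpha * \det (Y^t* *m Y)) ->
  (forall Y : 'M[C]_(n, k),
     \det (Y^t* *m P *m Y) <= beta * \det (Y^t* *m Y)) ->
  (forall Y : 'M[C]_(n, k),
     \det (Y^t* *m (T *m (Q *m Q) *m T) *m Y) <= gamma * \det (Y^t* *m Y)) ->
  \det (Z^t* *m ((S *m T) *m (Q *m P *m Q) *m (T *m S)) *m Z) <=
  alpha * beta * gamma * \det (Z^t* *m Z).
Proof.
move=> Sh Th Qh beta0 gamma0 leS leP leTQ.
have -> : Z^t* *m ((S *m T) *m (Q *m P *m Q) *m (T *m S)) *m Z =
    (Q *m T *m S *m Z)^t* *m P *m (Q *m T *m S *m Z).
  by rewrite !adjmxM Sh Th Qh !mulmxA.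
apply: le_trans (leP _) _; rewrite [alpha * _]mulrC -!mulrA ler_wpM2l //.
have -> : (Q *m T *m S *m Z)^t* *m (Q *m T *m S *m Z) =
    (S *m Z)^t* *m (T *m (Q *m Q) *m T) *m (S *m Z).
  by rewrite !adjmxM Sh Th Qh !mulmxA.
apply: le_trans (leTQ _) _; rewrite mulrCA ler_wpM2l //.
have -> : (S *m Z)^t* *m (S *m Z) = Z^t* *m (S *m S) *m Z.
  by rewrite adjmxM Sh !mulmxA.
exact: leS.
Qed.

(** * Unitary diagonalization *)

Definition udiag (C : numClosedFieldType) n (U : 'M[C]_n) (d : 'rV[C]_n) :
    'M[C]_n := U^t* *m diag_mx d *m U.

Lemma udiagM (C : numClosedFieldType) n (U : 'M[C]_n) (d e : 'rV[C]_n) :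
  U \is unitarymx ->
  udiag U d *m udiag U e = udiag U (\row_i (d 0 i * e 0 i)).
Proof.
move=> Uu; rewrite /udiag !mulmxA mulmxtVK //; congr (_ *m _).
by rewrite -mulmxA mulmx_diag.
Qed.

Lemma mxtrace_udiag (C : numClosedFieldType) n (U : 'M[C]_n) (d : 'rV[C]_n) :
  U \is unitarymx -> \tr (udiag U d) = \sum_i d 0 i.
Proof.
by move=> Uu; rewrite mxtrace_mulC mulmxA (unitarymxP Uu) mul1mx mxtrace_diag.
Qed.

Lemma adj_udiag (C : numClosedFieldType) n (U : 'M[C]_n) (d : 'rV[C]_n) :
  (forall i, 0 <= d 0 i) -> (udiag U d)^t* = udiag U d.
Proof.
move=> d0; rewrite /udiag !adjmxM trmxCK mulmxA tr_diag_mx map_diag_mx.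
congr (_ *m diag_mx _ *m _); apply/rowP => i.
by rewrite mxE; apply/CrealP/ger0_real.
Qed.

Lemma hermsymmx_adj (C : numClosedFieldType) n (A : 'M[C]_n) :
  (A \is hermsymmx) = (A == A^t*).
Proof. by rewrite qualifE /= expr0 scale1r. Qed.

Lemma perm_mx_unitary (C : numClosedFieldType) n (s : 'S_n) :
  (perm_mx s : 'M[C]_n) \is unitarymx.
Proof.
apply/unitarymxP; rewrite tr_perm_mx map_perm_mx -perm_mxM.
by rewrite mulgV perm_mx1.
Qed.

(** Lets the eigenvalues be listed in any order. *)
Lemma udiag_perm (C : numClosedFieldType) n (U : 'M[C]_n) (d : 'rV[C]_n)
    (s : 'S_n) :
  udiag U d = udiag (perm_mx s *m U) (\row_i d 0 (s i)).
Proof.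
rewrite /udiag adjmxM !mulmxA; congr (_ *m _); rewrite -!mulmxA; congr (_ *m _).
rewrite tr_perm_mx map_perm_mx.
apply/matrixP => i j; rewrite -row_permE -[X in _ *m perm_mx X]invgK -col_permE.
rewrite !mxE permKV.
by rewrite (inj_eq (@perm_inj _ s^-1%g)).
Qed.

(** The eigenvalue of index [i] is the value of the quadratic form at the
    [i]-th eigenvector, hence nonnegative. *)
Lemma psd_udiag (C : numClosedFieldType) n (A : 'M[C]_n) : A \is hermsymmx ->
  (forall v : 'cV[C]_n, 0 <= (v^t* *m A *m v) 0 0) ->
  exists (U : 'M[C]_n) (d : 'rV[C]_n),
    [/\ U \is unitarymx, forall i, 0 <= d 0 i & A = udiag U d].
Proof.
move=> Ah Apos; exists (spectralmx A), (spectral_diag A).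
have Uu := spectral_unitarymx A.
have AE : A = udiag (spectralmx A) (spectral_diag A).
  rewrite /udiag -invmx_unitary //.
  by apply/orthomx_spectralP; exact: hermitian_normalmx Ah.
split=> // i.
have := Apos ((spectralmx A)^t* *m delta_mx i 0).
rewrite [X in _ *m X *m _]AE /udiag adjmxM trmxCK !mulmxA.
rewrite !mulmxtVK //.
rewrite !mxE (bigD1 i) //= big1 => [|j ji]; last first.
  by rewrite !mxE (negbTE ji) mulr0.
rewrite addr0 !mxE !eqxx mulr1 (bigD1 i) //= big1 => [|j ji]; last first.
  by rewrite !mxE (negbTE ji) conjC0 mul0r.
by rewrite !mxE !eqxx conjC1 mul1r addr0.
Qed.

Lemma psd_congr (C : numClosedFieldType) n (D U : 'M[C]_n) (d : 'rV[C]_n) :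
  D^t* = D -> (forall i, 0 <= d 0 i) ->
  D *m udiag U d *m D \is hermsymmx /\
  forall v : 'cV[C]_n, 0 <= (v^t* *m (D *m udiag U d *m D) *m v) 0 0.
Proof.
move=> Dh d0; split.
  by rewrite hermsymmx_adj adjmxM (adjmxM D) Dh adj_udiag // mulmxA.
move=> v; set w := U *m D *m v.
have -> : v^t* *m (D *m udiag U d *m D) *m v = w^t* *m diag_mx d *m w.
  by rewrite /w /udiag !adjmxM Dh !mulmxA.
rewrite !mxE sumr_ge0 // => i _; rewrite mul_mx_diag !mxE mulrAC mulr_ge0 //.
by rewrite mulrC mul_conjC_ge0.
Qed.

(** The columns of [W] are the eigenvectors of the first [k] eigenvalues. *)
Lemma top_compression (C : numClosedFieldType) n (U : 'M[C]_n) (d : 'rV[C]_n) k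
    (kn : (k <= n)%N) : U \is unitarymx ->
  exists2 W : 'M[C]_(n, k), W^t* *m W = 1%:M &
    \det (W^t* *m udiag U d *m W) = \prod_i d 0 (widen_ord kn i).
Proof.
move=> Uu; pose S : 'M[C]_(k, n) := rowsub (widen_ord kn) 1%:M.
have SS (e : 'rV[C]_n) :
    S *m diag_mx e *m S^t* = diag_mx (\row_i e 0 (widen_ord kn i)).
  apply/matrixP => i j; rewrite !mxE (bigD1 (widen_ord kn j)) //=.
  rewrite big1 => [|l lj]; last first.
    by rewrite !mxE eq_sym (negbTE lj) conjC0 mulr0.
  rewrite addr0 mul_mx_diag !mxE eqxx conjC1 mulr1 mulr_natl.
  have -> : (widen_ord kn i == widen_ord kn j) = (i == j) by [].
  by case: eqVneq => [->|].
exists ((S *m U)^t*); rewrite trmxCK.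
  rewrite adjmxM mulmxA -(mulmxA S) (unitarymxP Uu) -(diag_const_mx n (1 : C)) SS.
  rewrite -(diag_const_mx k (1 : C)); congr diag_mx.
  by apply/rowP => i; rewrite !mxE.
rewrite /udiag adjmxM !mulmxA -(mulmxA S U) (unitarymxP Uu) mulmx1.
rewrite -(mulmxA _ U) (unitarymxP Uu) mulmx1 SS det_diag.
by apply: eq_bigr => i _; rewrite mxE.
Qed.

(** * Positive semidefinite matrices and their sorted eigenvalues *)

(** Eigenvalues are given by a sequence on [nat], of which the first [n] terms
    matter: partial products over [j < k] can then be written without casts
    between ordinals, and all real powers act pointwise on the sequence. *)
Definition eigmx (R : realType) n (U : 'M[R[i]]_n) (d : nat -> R) : 'M[R[i]]_n :=
  udiag U (\row_i (d i)%:C).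

Lemma eigmxM (R : realType) n (U : 'M[R[i]]_n) (d e : nat -> R) :
  U \is unitarymx ->
  eigmx U d *m eigmx U e = eigmx U (fun j => d j * e j).
Proof.
move=> Uu; rewrite /eigmx udiagM; last exact: Uu.
by congr udiag; apply/rowP => i; rewrite !mxE rmorphM.
Qed.

Lemma eq_eigmx (R : realType) n (U : 'M[R[i]]_n) (d e : nat -> R) :
  d =1 e -> eigmx U d = eigmx U e.
Proof. by move=> de; congr udiag; apply/rowP => i; rewrite !mxE de. Qed.

Lemma eigmx_powD (R : realType) n (U : 'M[R[i]]_n) (d : nat -> R) (s t : R) :
  U \is unitarymx -> 0 <= s -> 0 <= t ->
  eigmx U (fun j => d j `^ s) *m eigmx U (fun j => d j `^ t) =
  eigmx U (fun j => d j `^ (s + t)).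
Proof.
move=> Uu s0 t0; rewrite (eigmxM _ _ Uu); apply: eq_eigmx => j.
by rewrite powRD_ge0.
Qed.

Lemma adj_eigmx (R : realType) n (U : 'M[R[i]]_n) (d : nat -> R) :
  (forall j, 0 <= d j) -> (eigmx U d)^t* = eigmx U d.
Proof. by move=> d0; apply: adj_udiag => i; rewrite mxE ler0c. Qed.

Lemma rtr_eigmx (R : realType) n (U : 'M[R[i]]_n) (d : nat -> R) :
  U \is unitarymx ->
  rtr (eigmx U d) = \sum_(j < n) d j.
Proof.
move=> Uu; rewrite /rtr mxtrace_udiag; last exact: Uu.
by under eq_bigr do rewrite mxE; rewrite -rmorph_sum.
Qed.

Lemma mxpow_eigmx (R : realType) n (A U : 'M[R[i]]_n) (d : nat -> R) (s : R) :
  U \is unitarymx -> A = eigmx U d -> mxpow A s = eigmx U (fun j => d j `^ s).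
Proof.
move=> Uu ->; rewrite /mxpow /eigmx /udiag -(invmx_unitary Uu) (mxfunE _ _ Uu).
rewrite [map_mx _ _](_ : _ = \row_i (d i `^ s)%:C); last first.
  by apply/rowP => i; rewrite !mxE.
reflexivity.
Qed.

Lemma rtr_mxpow_eigmx (R : realType) n (A U : 'M[R[i]]_n) (d : nat -> R) (s : R) :
  U \is unitarymx -> A = eigmx U d -> rtr (mxpow A s) = \sum_(j < n) d j `^ s.
Proof. by move=> Uu AE; rewrite (mxpow_eigmx s Uu AE) (rtr_eigmx _ Uu). Qed.

(** The sequence is obtained by sorting the eigenvalues, and is [0] from the
    index [n] on, which keeps it decreasing on all of [nat]. *)
Lemma psd_eigmx (R : realType) n (A : 'M[R[i]]_n) : psd A ->
  exists U (d : nat -> R),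
    [/\ U \is unitarymx, nonincreasing_seq d, forall j, 0 <= d j & A = eigmx U d].
Proof.
case=> Ah Apos; have [U [e [Uu e0 ->]]] := psd_udiag Ah Apos.
pose s := [tuple complex.Re (e 0 i) | i < n].
have eE i : (tnth s i)%:C = e 0 i by rewrite tnth_mktuple RRe_real // ger0_real.
have s_ge0 i : 0 <= tnth s i by rewrite -ler0c eE.
have /tuple_permP[p sE] : perm_eq (sort >=%R s) s by rewrite perm_sort.
have size_s : size (sort >=%R s) = n by rewrite size_sort size_tuple.
pose d j := nth 0 (sort >=%R s) j.
have dE (i : 'I_n) : d i = tnth s (p i).
  by rewrite /d sE -tnth_nth tnth_mktuple.
have d0 j : 0 <= d j.
  have [jn|jn] := ltnP j n; first by rewrite (dE (Ordinal jn)).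
  by rewrite /d nth_default // size_s.
exists (perm_mx p *m U), d; split; last 1 first.
- rewrite (udiag_perm _ _ p); congr udiag; apply/rowP => i.
  by rewrite !mxE dE eE.
- exact: mul_unitarymx (perm_mx_unitary _ p) Uu.
- move=> i j ij; have [jn|jn] := ltnP j n; last first.
    by rewrite {1}/d nth_default ?size_s.
  have := @sorted_leq_nth _ >=%R (@ge_trans _ _) (@ge_refl _ _) 0 (sort >=%R s).
  apply=> //; rewrite ?inE ?size_s //; first exact: (sort_sorted (@ge_total _ _)).
  exact: leq_ltn_trans jn.
- exact: d0.
Qed.

Lemma eigmx_congr_psd (R : realType) n (U V : 'M[R[i]]_n) (d e : nat -> R) :
  (forall j, 0 <= d j) -> (forall j, 0 <= e j) ->
  psd (eigmx U d *m eigmx V e *m eigmx U d).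
Proof.
move=> d0 e0; apply: psd_congr => [|i]; first exact: adj_eigmx.
by rewrite mxE ler0c.
Qed.

Lemma eigmx_psd (R : realType) n (U : 'M[R[i]]_n) (d : nat -> R) :
  U \is unitarymx -> (forall j, 0 <= d j) -> psd (eigmx U d).
Proof.
move=> Uu d0; have := @eigmx_congr_psd R n U U (fun=> 1) d.
rewrite (eigmxM _ _ Uu) (eigmxM _ _ Uu); under eq_eigmx do rewrite mul1r mulr1.
by apply=> // j; exact: ler01.
Qed.

(** The product of the [k] largest eigenvalues bounds the multiplicative effect
    of a positive semidefinite matrix on Gram determinants of size [k]. *)
Lemma det_eigmx_le (R : realType) n k (U : 'M[R[i]]_n) (d : nat -> R)
    (Y : 'M[R[i]]_(n, k)) :
  U \is unitarymx -> nonincreasing_seq d -> (forall j, 0 <= d j) ->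
  \det (Y^t* *m eigmx U d *m Y) <= (\prod_(j < k) d j)%:C * \det (Y^t* *m Y).
Proof.
move=> Uu d_dec d0; apply: det_compression_le => [|f f_inj]; first exact: Uu.
under eq_bigr do rewrite mxE; rewrite -rmorph_prod lecR.
exact: prod_inj_le.
Qed.

Lemma eigmx_top (R : realType) n k (U : 'M[R[i]]_n) (d : nat -> R) : (k <= n)%N ->
  U \is unitarymx ->
  exists2 W : 'M[R[i]]_(n, k), W^t* *m W = 1%:M &
    \det (W^t* *m eigmx U d *m W) = (\prod_(j < k) d j)%:C.
Proof.
move=> kn Uu; have [W W1 WE] := top_compression (\row_i (d i)%:C) kn Uu.
exists W; first exact: W1.
rewrite [LHS]WE; under eq_bigr do rewrite mxE.
by rewrite rmorph_prod.
Qed.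

(** * The operator norm *)

Lemma l2norm_ge0 (R : realType) n (v : 'cV[R[i]]_n) : 0 <= l2norm v.
Proof. exact: sqrtr_ge0. Qed.

Lemma sqr_l2norm (R : realType) n (v : 'cV[R[i]]_n) :
  (l2norm v ^+ 2)%:C = (v^t* *m v) 0 0.
Proof.
rewrite /l2norm sqr_sqrtr; last by apply: sumr_ge0 => i _; exact: sqr_ge0.
rewrite rmorph_sum mxE; apply: eq_bigr => i _.
by rewrite rmorphXn [X in X ^+ 2](RRe_real (normr_real (v i 0))) !mxE normCKC.
Qed.

(** The case [k = 1] of [det_eigmx_le], for the square of the matrix. *)
Lemma l2norm_eigmx_le (R : realType) n (U : 'M[R[i]]_n) (d : nat -> R)
    (v : 'cV[R[i]]_n) :
  U \is unitarymx -> nonincreasing_seq d -> (forall j, 0 <= d j) ->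
  l2norm (eigmx U d *m v) <= d 0%N * l2norm v.
Proof.
move=> Uu d_dec d0.
rewrite -(@ler_pXn2r _ 2) ?nnegrE ?mulr_ge0 ?l2norm_ge0 // exprMn.
rewrite -lecR (rmorphM _ (d 0%N ^+ 2)) /= !sqr_l2norm adjmxM (adj_eigmx _ d0).
rewrite -mulmxA (mulmxA (eigmx U d)) (eigmxM _ _ Uu) mulmxA.
have := @det_eigmx_le R n 1 U (fun j => d j * d j) v Uu.
rewrite !det_mx11 big_ord_recl big_ord0 mulr1 -expr2; apply.
- by move=> i j ij; rewrite ler_pM ?d_dec.
- by move=> j; rewrite mulr_ge0.
Qed.

(** The supremum is attained at a unit eigenvector for the top eigenvalue. *)
Lemma opnorm_eigmx (R : realType) n (U : 'M[R[i]]_n.+1) (d : nat -> R) :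
  U \is unitarymx -> nonincreasing_seq d -> (forall j, 0 <= d j) ->
  opnorm (eigmx U d) = d 0%N.
Proof.
move=> Uu d_dec d0.
have ub : ubound [set l2norm (eigmx U d *m v) | v in
    [set v : 'cV[R[i]]_n.+1 | l2norm v <= 1]]%classic (d 0%N).
  move=> _ [v /= v1 <-]; apply: le_trans (l2norm_eigmx_le v Uu d_dec d0) _.
  by rewrite ler_piMr.
have [W W1 WE] := eigmx_top (fun j => d j * d j) (ltn0Sn n : (1 <= n.+1)%N) Uu.
have W1' : l2norm W = 1.
  apply/eqP; rewrite -(@eqrXn2 _ 2) ?l2norm_ge0 // expr1n; apply/eqP/complexI.
  by rewrite sqr_l2norm W1 mxE.
have AW : l2norm (eigmx U d *m W) = d 0%N.
  apply/eqP; rewrite -(@eqrXn2 _ 2) ?l2norm_ge0 //; apply/eqP/complexI.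
  rewrite sqr_l2norm adjmxM (adj_eigmx _ d0).
  rewrite -mulmxA (mulmxA (eigmx U d)) (eigmxM _ _ Uu) mulmxA.
  by move: WE; rewrite det_mx11 big_ord_recl big_ord0 mulr1 -expr2.
have inS : [set l2norm (eigmx U d *m v) | v in
    [set v : 'cV[R[i]]_n.+1 | l2norm v <= 1]]%classic (d 0%N).
  by exists W => //=; rewrite W1'.
apply/eqP; rewrite eq_le; apply/andP; split.
  by apply: ge_sup => //; exists (d 0%N).
by apply: ub_le_sup => //; exists (d 0%N).
Qed.

(** * Real powers of positive semidefinite matrices *)

Lemma mxpowK (R : realType) n (A : 'M[R[i]]_n) (s t : R) : psd A ->
  mxpow (mxpow A s) t = mxpow A (s * t).
Proof.
move=> /psd_eigmx[U [a [Uu _ _ AE]]]; have AsE := mxpow_eigmx s Uu AE.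
rewrite (mxpow_eigmx t Uu AsE) (mxpow_eigmx (s * t) Uu AE).
by apply: eq_eigmx => j; rewrite powRrM.
Qed.

Lemma mxpow1 (R : realType) n (A : 'M[R[i]]_n) : psd A -> mxpow A 1 = A.
Proof.
move=> /psd_eigmx[U [a [Uu _ a0 AE]]]; rewrite (mxpow_eigmx 1 Uu AE) AE.
by apply: eq_eigmx => j; rewrite powRr1.
Qed.

Lemma psd_mxpow (R : realType) n (A : 'M[R[i]]_n) (s : R) :
  psd A -> psd (mxpow A s).
Proof.
move=> /psd_eigmx[U [a [Uu _ _ AE]]]; rewrite (mxpow_eigmx s Uu AE).
by apply: eigmx_psd => // j; exact: powR_ge0.
Qed.

Lemma opnorm_mxpow (R : realType) n (A : 'M[R[i]]_n.+1) (s : R) :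
  psd A -> 0 <= s ->
  opnorm (mxpow A s) = opnorm A `^ s.
Proof.
move=> /psd_eigmx[U [a [Uu a_dec a0 ->]]] s0; rewrite (mxpow_eigmx s Uu (erefl _)).
have pow_ge0 j : 0 <= a j `^ s by exact: powR_ge0.
apply: etrans (opnorm_eigmx Uu (nonincreasing_powR s0 a_dec a0) pow_ge0) _.
by rewrite (opnorm_eigmx Uu a_dec a0).
Qed.

Lemma rtr_mxpow_ge0 (R : realType) n (A : 'M[R[i]]_n) (s : R) : psd A ->
  0 <= rtr (mxpow A s).
Proof.
move=> /psd_eigmx[U [a [Uu _ _ AE]]]; rewrite (rtr_mxpow_eigmx s Uu AE).
by apply: sumr_ge0 => j _; exact: powR_ge0.
Qed.

Lemma psd_sandwich (R : realType) n (A B : 'M[R[i]]_n) : psd A -> psd B ->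
  psd (A *m B *m A).
Proof.
move=> /psd_eigmx[U [a [Uu _ a0 ->]]] /psd_eigmx[V [b [Vu _ b0 ->]]].
exact: eigmx_congr_psd.
Qed.

(** * The trace inequality *)

(** Evaluate [det_sandwich_le] at the matrix [Z] of the eigenvectors of [ABA]
    for [l_0], ..., [l_(k-1)], with [S = A^(1-r)], [T = A^r],
    [P = B^(1-r)] and [Q = B^(r/2)], so that [T Q^2 T = A^r B^r A^r]. *)
Lemma log_majorization (R : realType) n k (U V W X : 'M[R[i]]_n)
    (a b c l : nat -> R) (r : R) :
  U \is unitarymx -> V \is unitarymx -> W \is unitarymx -> X \is unitarymx ->
  nonincreasing_seq a -> nonincreasing_seq b -> nonincreasing_seq c ->
  (forall j, 0 <= a j) -> (forall j, 0 <= b j) -> (forall j, 0 <= c j) ->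
  0 <= r <= 1 ->
  eigmx U a *m eigmx V b *m eigmx U a = eigmx X l ->
  eigmx U (fun j => a j `^ r) *m eigmx V (fun j => b j `^ r) *m
    eigmx U (fun j => a j `^ r) = eigmx W c ->
  (k <= n)%N ->
  \prod_(j < k) l j <=
  \prod_(j < k) (a 0%N `^ (2 * (1 - r)) * b j `^ (1 - r) * c j).
Proof.
move=> Uu Vu Wu Xu a_dec b_dec c_dec a0 b0 c0 /andP[r0 r1] lE cE kn.
have s0 : 0 <= 1 - r by rewrite subr_ge0.
have h0 : 0 <= r / 2 by rewrite divr_ge0.
have s0' : 0 <= 1 - r + (1 - r) by rewrite addr_ge0.
pose A t := eigmx U (fun j => a j `^ t); pose B t := eigmx V (fun j => b j `^ t).
have pow1 (Q : 'M[R[i]]_n) d : (forall j, 0 <= d j) ->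
    eigmx Q d = eigmx Q (fun j => d j `^ (1 : R)).
  by move=> d0; apply: eq_eigmx => j; rewrite powRr1.
have AD s t : 0 <= s -> 0 <= t -> A s *m A t = A (s + t) by exact: eigmx_powD.
have BD s t : 0 <= s -> 0 <= t -> B s *m B t = B (s + t) by exact: eigmx_powD.
have A_adj t : (A t)^t* = A t by apply: adj_eigmx => j; exact: powR_ge0.
have B_adj t : (B t)^t* = B t by apply: adj_eigmx => j; exact: powR_ge0.
have A1l : A (1 - r) *m A r = eigmx U a.
  by rewrite (AD _ _ s0 r0) subrK; exact/esym/pow1.
have A1r : A r *m A (1 - r) = eigmx U a.
  by rewrite (AD _ _ r0 s0) addrC subrK; exact/esym/pow1.
have B1 : B (r / 2) *m B (1 - r) *m B (r / 2) = eigmx V b.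
  rewrite (BD _ _ h0 s0) (BD _ _ (addr_ge0 h0 s0) h0).
  have -> : r / 2 + (1 - r) + r / 2 = 1 by field.
  exact/esym/pow1.
have prod_ge0 (x : nat -> R) : (forall j, 0 <= x j) -> 0 <= (\prod_(j < k) x j)%:C.
  by move=> x0; rewrite ler0c prodr_ge0.
have leA (Y : 'M[R[i]]_(n, k)) := det_eigmx_le Y Uu
  (nonincreasing_powR s0' a_dec a0) (fun j => powR_ge0 _ _).
have leB (Y : 'M[R[i]]_(n, k)) := det_eigmx_le Y Vu
  (nonincreasing_powR s0 b_dec b0) (fun j => powR_ge0 _ _).
have leC (Y : 'M[R[i]]_(n, k)) := det_eigmx_le Y Wu c_dec c0.
have [Z Z1 ZE] := eigmx_top l kn Xu.
have AA := AD _ _ s0 s0; have BB := BD _ _ h0 h0; rewrite -splitr in BB.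
rewrite -/(A r) -/(B r) in cE.
rewrite -/(A (1 - r + (1 - r))) in leA; rewrite -/(B (1 - r)) in leB.
(* Only the relations between these powers matter from here on. *)
clearbody A B; rewrite -AA in leA; rewrite -cE -BB in leC.
have := det_sandwich_le Z (A_adj _) (A_adj _) (B_adj _)
  (prod_ge0 _ (fun j => powR_ge0 (b j) (1 - r))) (prod_ge0 _ c0) leA leB leC.
rewrite A1l A1r B1 lE ZE Z1 det1 mulr1.
rewrite -!rmorphM lecR -!big_split => /le_trans; apply.
apply: ler_prod => j _; rewrite !mulr_ge0 ?powR_ge0 //=.
rewrite mulr_natl mulr2n ler_wpM2r // ler_wpM2r ?powR_ge0 //.
by rewrite ge0_ler_powR ?nnegrE ?a_dec.
Qed.

(** The case [0 <= r <= 1].  The size is positive because the operator norm is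
    replaced by the largest eigenvalue, which an empty matrix does not have. *)
Lemma rtr_mxpow_sandwich_le (R : realType) (n : nat) (A B : 'M[R[i]]_n.+1)
    (q r : R) :
  psd A -> psd B -> 0 <= q -> 0 <= r <= 1 ->
  rtr (mxpow (A *m B *m A) (r * q)) <=
    (opnorm A `^ (2 * r * q) * rtr (mxpow B (r * q))) `^ (1 - r) *
    rtr (mxpow (mxpow A r *m mxpow B r *m mxpow A r) q) `^ r.
Proof.
move=> /psd_eigmx[U [a [Uu a_dec a0 ->]]].
move=> /psd_eigmx[V [b [Vu b_dec b0 ->]]] q0 r01.
have [r0 r1] := andP r01; have rq0 : 0 <= r * q by rewrite mulr_ge0.
have [X [l [Xu l_dec l0 lE]]] := psd_eigmx (eigmx_congr_psd U V a0 b0).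
have [W [c [Wu c_dec c0 cE]]] := psd_eigmx
  (eigmx_congr_psd U V (fun j => powR_ge0 (a j) r) (fun j => powR_ge0 (b j) r)).
have cE' : mxpow (eigmx U a) r *m mxpow (eigmx V b) r *m mxpow (eigmx U a) r =
    eigmx W c.
  by rewrite (mxpow_eigmx r Uu (erefl _)) (mxpow_eigmx r Vu (erefl _)).
suff core : \sum_(j < n.+1) l j `^ (r * q) <=
    (a 0%N `^ (2 * r * q) * \sum_(j < n.+1) b j `^ (r * q)) `^ (1 - r) *
    (\sum_(j < n.+1) c j `^ q) `^ r.
  move: core; rewrite -(rtr_mxpow_eigmx _ Xu lE) -(rtr_mxpow_eigmx _ Vu (erefl _)).
  by rewrite -(rtr_mxpow_eigmx _ Wu cE') -(opnorm_eigmx Uu a_dec a0).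
rewrite mulr_sumr.
have ab_ge0 j : 0 <= a 0%N `^ (2 * r * q) * b j `^ (r * q).
  by rewrite mulr_ge0 ?powR_ge0.
apply: (@le_trans _ _ (\sum_(j < n.+1)
    (a 0%N `^ (2 * r * q) * b j `^ (r * q)) `^ (1 - r) *
    (c j `^ q) `^ r)); last first.
  by apply: sum_powR_hoelder => // j; exact: powR_ge0.
apply: (@prod_le_sum_le _ (fun j => l j `^ (r * q)) (fun j =>
    (a 0%N `^ (2 * r * q) * b j `^ (r * q)) `^ (1 - r) * (c j `^ q) `^ r))
  => [|j|j|k kn]; first exact: nonincreasing_powR.
- exact: powR_ge0.
- by rewrite mulr_ge0 ?powR_ge0.
have maj := log_majorization Uu Vu Wu Xu a_dec b_dec c_dec a0 b0 c0 r01 lE cE kn.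
rewrite powR_prod //.
have -> : \prod_(j < k) ((a 0%N `^ (2 * r * q) * b j `^ (r * q)) `^ (1 - r) *
    (c j `^ q) `^ r) =
    (\prod_(j < k) (a 0%N `^ (2 * (1 - r)) * b j `^ (1 - r) * c j)) `^ (r * q).
  rewrite -(powR_prod k
    (x := fun j => a 0%N `^ (2 * (1 - r)) * b j `^ (1 - r) * c j))
    => [|j]; last by rewrite !mulr_ge0 ?powR_ge0.
  apply: eq_bigr => j _; rewrite !powRM ?mulr_ge0 ?powR_ge0 // -!powRrM.
  by rewrite [q * r]mulrC [r * q * _]mulrC; congr (_ `^ _ * _ * _); ring.
apply: ge0_ler_powR => //; rewrite nnegrE prodr_ge0 // => j _.
by rewrite !mulr_ge0 ?powR_ge0.
Qed.

Theorem theorem2 (R : realType) (n : nat) (A B : 'M[R[i]]_n) (q r : R)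
    (hA : psd A) (hB : psd B) (hq : 0 <= q) :
  (0 <= r <= 1 ->
     rtr (mxpow (A *m B *m A) (r * q)) <=
       (opnorm A `^ (2 * r * q) * rtr (mxpow B (r * q))) `^ (1 - r) *
       rtr (mxpow (mxpow A r *m mxpow B r *m mxpow A r) q) `^ r) /\
  (1 <= r ->
     rtr (mxpow (A *m B *m A) (r * q)) >=
       (opnorm A `^ (2 * r * q) * rtr (mxpow B (r * q))) `^ (1 - r) *
       rtr (mxpow (mxpow A r *m mxpow B r *m mxpow A r) q) `^ r).
Proof.
case: n => [|n] in A B hA hB *.
  (* The traces of empty matrices vanish, and [0 `^ r = 0] when [1 <= r]. *)
  have tr0 (M : 'M[R[i]]_0) : rtr M = 0 by rewrite /rtr /mxtrace big_ord0.
  split=> [_|r1].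
    by rewrite [leLHS]tr0; exact: mulr_ge0 (powR_ge0 _ _) (powR_ge0 _ _).
  have rN0 : r != 0 by rewrite gt_eqF // (lt_le_trans ltr01).
  by rewrite [X in _ * X `^ r <= _]tr0 (powR0 rN0) mulr0 [leRHS]tr0.
split=> [r01|r1]; first exact: rtr_mxpow_sandwich_le.
have r0 : 0 < r := lt_le_trans ltr01 r1.
have rV01 : 0 <= r^-1 <= 1 by rewrite invr_ge0 ltW //= invf_le1.
have rq0 : 0 <= r * q by rewrite mulr_ge0 // ltW.
apply: powR_le_solve => //.
- exact: rtr_mxpow_ge0 (psd_sandwich (psd_mxpow r hA) (psd_mxpow r hB)).
- exact: rtr_mxpow_ge0 (psd_sandwich hA hB).
have := rtr_mxpow_sandwich_le (psd_mxpow r hA) (psd_mxpow r hB) rq0 rV01.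
have rV : r * r^-1 = 1 by rewrite mulfV // gt_eqF.
have qE : r^-1 * (r * q) = q by rewrite mulrA mulVf ?mul1r // gt_eqF.
have twoE : r * (2 * r^-1 * (r * q)) = 2 * r * q by field; rewrite gt_eqF.
rewrite qE (mxpowK r r^-1 hA) (mxpowK r r^-1 hB) rV (mxpow1 hA) (mxpow1 hB).
by rewrite (mxpowK r q hB) (opnorm_mxpow hA (ltW r0)) -powRrM twoE.
Qed.
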